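(* Let $\mathbb{C}$ be a modified category of interest and let $\mathbf{Ab}(\mathbb{C})$ be its full subcategory of singular objects. Let $$A\rightarrowtail B\overset{f}{\twoheadrightarrow} C$$ be an extension in $\mathbb{C}$ (i.e. $f$ is a surjective morphism with kernel $A$). Then the extension is a central extension of $C$ by $A$ (i.e. $A\in\mathbf{Ab}(\mathbb{C})$ and $A$ is a subobject of $Z(B)$) if and only if $f:B\to C$ is central in the sense of Janelidze and Kelly relative to the admissible subcategory $\mathbf{Ab}(\mathbb{C})$ of $\mathbb{C}$.
   Context: **Modified category of interest.** Let $\mathbb{C}$ be a category of groups with a set of operations $\Omega$ and a set of identities $\mathbb{E}$ (objects are the algebras with operations $\Omega$ satisfying $\mathbb{E}$, morphisms are the maps preserving all operations), where $\mathbb{E}$ includes the group identities. Let $\Omega_i$ be the set of $i$-ary operations in $\Omega$. $\mathbb{C}$ is a modified category of interest if: (a) $\Omega=\Omega_0\cup\Omega_1\cup\Omega_2$; (b) the group operations, written additively $0,-,+$ (the group need not be commutative), are elements of $\Omega_0,\Omega_1,\Omega_2$ respectively; with $\Omega_2'=\Omega_2\setminus\{+\}$ and $\Omega_1'=\Omega_1\setminus\{-\}$, if $\ast\in\Omega_2'$ then $\Omega_2'$ contains $\ast^\circ$ defined by $x\ast^\circ y=y\ast x$; and $\Omega_0=\{0\}$; (c) for each $\ast\in\Omega_2'$, $\mathbb{E}$ includes $x\ast(y+z)=x\ast y+x\ast z$; (d) for each $\omega\in\Omega_1'$ and $\ast\in\Omega_2'$, $\mathbb{E}$ includes $\omega(x+y)=\omega(x)+\omega(y)$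 and $\omega(x\ast y)=\omega(x)\ast\omega(y)$; and for every object $C$ and $x_1,x_2,x_3\in C$: (Axiom 1) $x_1+(x_2\ast x_3)=(x_2\ast x_3)+x_1$ for each $\ast\in\Omega_2'$; (Axiom 2) for each ordered pair $(\ast,\overline{\ast})\in\Omega_2'\times\Omega_2'$ there is a word $W$ such that $(x_1\ast x_2)\overline{\ast}x_3=W(x_1(x_2x_3),x_1(x_3x_2),(x_2x_3)x_1,(x_3x_2)x_1,x_2(x_1x_3),x_2(x_3x_1),(x_1x_3)x_2,(x_3x_1)x_2)$, where each juxtaposition represents an operation in $\Omega_2'$. **Center, singularity, commutator.** For $A\in\mathbb{C}$, the center is $Z(A)=\{z\in A\mid a+z=z+a,\ a+\omega(z)=\omega(z)+a,\ a\ast z=0,\ a\ast\omega(z)=0\ \text{for all } a\in A,\ \omega\in\Omega_1,\ \ast\in\Omega_2'\}$. An object is singular if it coincides with its center; $\mathbf{Ab}(\mathbb{C})$ is the full subcategory of singular objects. An ideal is a kernel of a morphism. The commutator $[A,A]$ is the smallest ideal of $A$ containing $\{x+y-x-y,\ x+\omega(y)-x-\omega(y),\ x\ast y,\ x\ast\omega(y)\mid x,y\in A,\ \omega\in\Omega_1,\ \ast\in\Omega_2'\}$. The functor $\mathfrak{Sing}:\mathbb{C}\to\mathbf{Ab}(\mathbb{C})$, $A\mapsto A/[A,A]$, is left adjoint to the inclusion $\mathbf{Ab}(\mathbb{C})\to\mathbb{C}$; the unit of the adjunction is the quotient map $A\to\mathfrak{Sing}(A)$. **Centrality in the sense of Janelidze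 and Kelly.** An extension (surjective morphism) $f:A\to B$ in $\mathbb{C}$ is trivial if the square with sides $f:A\to B$, $\mathfrak{Sing}(f):\mathfrak{Sing}(A)\to\mathfrak{Sing}(B)$ and the unit morphisms $A\to\mathfrak{Sing}(A)$, $B\to\mathfrak{Sing}(B)$ is a pullback. An extension $f:A\to B$ is central if there exists an extension $\rho:E\to B$ of $B$ such that in the pullback $E\times_B A$ of $f$ along $\rho$, the projection $\pi_1:E\times_B A\to E$ is a trivial extension. *)

(* Defs.v *)
From mathcomp Require Import all_boot.
From mathcomp Require Import boolp classical_sets.

Set Implicit Arguments.
Unset Strict Implicit.
Unset Printing Implicit Defensive.

Local Open Scope classical_set_scope.
Local Open Scope quotient_scope.

(* The operations are 0, -, + together with one unary (resp. binary) operation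
   for each element of [un_op] (resp. [bin_op]); thus [un_op] and [bin_op] stand
   for Omega_1' and Omega_2'. *)
Record signature : Type := Signature { un_op : Type; bin_op : Type }.

Inductive term (S : signature) (V : Type) : Type :=
| TVar of V
| TZero
| TOpp of term S V
| TAdd of term S V & term S V
| TUn of un_op S & term S V
| TBin of bin_op S & term S V & term S V.

Record algebra (S : signature) : Type := Algebra {
  carrier :> Type;
  zero : carrier;
  opp : carrier -> carrier;
  add : carrier -> carrier -> carrier;
  un : un_op S -> carrier -> carrier;
  bin : bin_op S -> carrier -> carrier -> carrier }.

Arguments zero {S a}.
Arguments opp {S a} x.
Arguments add {S a} x y.
Arguments un {S a} w x.
Arguments bin {S a} o x y.

Declare Scope mci_scope.
Delimit Scope mci_scope with mci.
Reserved Notation "x *[ o ] y" (at level 40, left associativity).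
Notation "0" := zero : mci_scope.
Notation "- x" := (opp x) : mci_scope.
Notation "x + y" := (add x y) : mci_scope.
Notation "x - y" := (add x (opp y)) : mci_scope.
Notation "x *[ o ] y" := (bin o x y) : mci_scope.
Local Open Scope mci_scope.

(* All of Omega_1: [None] is the group inverse. *)
Definition un1 (S : signature) (A : algebra S) (w : option (un_op S)) (x : A) : A :=
  if w is Some w' then un w' x else - x.

Fixpoint eval (S : signature) (V : Type) (A : algebra S) (e : V -> A)
    (t : term S V) : A :=
  match t with
  | TVar v => e v
  | TZero => 0
  | TOpp t1 => - eval e t1
  | TAdd t1 t2 => eval e t1 + eval e t2
  | TUn w t1 => un w (eval e t1)
  | TBin o t1 t2 => eval e t1 *[o] eval e t2
  end.

Record variety : Type := Variety {
  sig :> signature;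
  identities : term sig nat -> term sig nat -> Prop }.

Record object (T : variety) : Type := Object {
  obj_alg :> algebra T;
  objP : forall s t : term T nat, identities s t ->
         forall e : nat -> obj_alg, eval e s = eval e t }.

Record hom (S : signature) (A B : algebra S) : Type := Hom {
  hom_fun :> A -> B;
  hom0 : hom_fun 0 = 0;
  homN : forall x, hom_fun (- x) = - hom_fun x;
  homD : forall x y, hom_fun (x + y) = hom_fun x + hom_fun y;
  homU : forall w x, hom_fun (un w x) = un w (hom_fun x);
  homM : forall o x y, hom_fun (x *[o] y) = hom_fun x *[o] hom_fun y }.

Definition surjective (S : signature) (A B : algebra S) (f : hom A B) : Prop :=
  forall y, exists x, f x = y.

Definition kernel (S : signature) (A B : algebra S) (f : hom A B) : set A :=
  [set x | f x = 0].

(* The eight shapes allowed in the word W; [p] and [q] are the outer and the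
   inner operation. *)
Definition shape (S : signature) (A : algebra S) (x1 x2 x3 : A)
    (m : 'I_8 * bin_op S * bin_op S) : A :=
  let: (i, p, q) := m in
  nth 0 [:: x1 *[p] (x2 *[q] x3); x1 *[p] (x3 *[q] x2);
            (x2 *[q] x3) *[p] x1; (x3 *[q] x2) *[p] x1;
            x2 *[p] (x1 *[q] x3); x2 *[p] (x3 *[q] x1);
            (x1 *[q] x3) *[p] x2; (x3 *[q] x1) *[p] x2] i.

(* That the set of identities includes a given identity is read semantically:
   the identity holds in every object.  In [mci_axiom2] the word W may depend on
   the two operations but not on the object; its letters are the eight shapes,
   with arbitrary operations from Omega_2' at each occurrence. *)
Record modified_category_of_interest : Type := MCI {
  mci_variety :> variety;
  mci_addA : forall (A : object mci_variety) (x y z : A), x + (y + z) = (x + y) + z;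
  mci_add0x : forall (A : object mci_variety) (x : A), 0 + x = x;
  mci_addx0 : forall (A : object mci_variety) (x : A), x + 0 = x;
  mci_addNx : forall (A : object mci_variety) (x : A), - x + x = 0;
  mci_addxN : forall (A : object mci_variety) (x : A), x - x = 0;
  mci_opposite : forall o : bin_op mci_variety, exists o' : bin_op mci_variety,
    forall (A : object mci_variety) (x y : A), x *[o'] y = y *[o] x;
  mci_binDr : forall (A : object mci_variety) o (x y z : A),
    x *[o] (y + z) = x *[o] y + x *[o] z;
  mci_unD : forall (A : object mci_variety) w (x y : A),
    un w (x + y) = un w x + un w y;
  mci_unM : forall (A : object mci_variety) w o (x y : A),
    un w (x *[o] y) = un w x *[o] un w y;
  mci_axiom1 : forall (A : object mci_variety) o (x1 x2 x3 : A),
    x1 + (x2 *[o] x3) = (x2 *[o] x3) + x1;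
  mci_axiom2 : forall o o' : bin_op mci_variety,
    exists W : term mci_variety ('I_8 * bin_op mci_variety * bin_op mci_variety),
    forall (A : object mci_variety) (x1 x2 x3 : A),
      (x1 *[o] x2) *[o'] x3 = eval (shape x1 x2 x3) W }.

Section Center.
Variables (S : signature) (A : algebra S).

Definition center : set A := [set z |
  [/\ forall a, a + z = z + a,
      forall a w, a + un1 w z = un1 w z + a,
      forall a o, a *[o] z = 0 &
      forall a w o, a *[o] un1 w z = 0]].

Definition singular : Prop := center = [set: A].

Definition commutator_gens : set A := [set u |
  exists x y : A,
    [\/ u = x + y - x - y,
        exists w, u = x + un1 w y - x - un1 w y,
        exists o, u = x *[o] y |
        exists w o, u = x *[o] un1 w y]].
End Center.
Arguments center {S} A.
Arguments commutator_gens {S} A.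

Definition is_ideal (T : variety) (A : object T) (I : set A) : Prop :=
  exists (D : object T) (g : hom A D), I = kernel g.

Definition commutator (T : variety) (A : object T) : set A :=
  smallest (@is_ideal T A) (commutator_gens A).
Arguments commutator {T} A.

Section Sing.
Variables (C : modified_category_of_interest).

Lemma sub_eq0 (A : object C) (x y : A) : x - y = 0 <-> x = y.
Proof.
split=> [h|->]; last exact: mci_addxN.
by rewrite -[x]mci_addx0 -(mci_addNx y) mci_addA h mci_add0x.
Qed.

Lemma commutator_subP (A : object C) (x y : A) :
  commutator A (x - y) <->
  forall (D : object C) (g : hom A D),
    commutator_gens A `<=` kernel g -> g x = g y.
Proof.
split=> [h D g hg|h I [[D [g ->]] hg]].
  have : kernel g (x - y) by apply: h; split => //; exists D, g.
  by rewrite /kernel /= homD homN => /sub_eq0.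
by rewrite /kernel /= homD homN; apply/sub_eq0; exact: h.
Qed.

Variable A : object C.

Definition comm_rel (x y : {classic A}) : bool :=
  `[< commutator A ((x : A) - (y : A)) >].

Lemma comm_relP (x y : A) : reflect (commutator A (x - y)) (comm_rel x y).
Proof. exact: asboolP. Qed.

Lemma comm_rel_refl : reflexive comm_rel.
Proof. by move=> x; apply/comm_relP/commutator_subP. Qed.

Lemma comm_rel_sym : symmetric comm_rel.
Proof.
move=> x y; apply/idP/idP => /comm_relP/commutator_subP h;
  by apply/comm_relP/commutator_subP => D g /h.
Qed.

Lemma comm_rel_trans : transitive comm_rel.
Proof.
move=> y x z /comm_relP/commutator_subP h /comm_relP/commutator_subP k.
by apply/comm_relP/commutator_subP => D g hg; rewrite (h _ _ hg) (k _ _ hg).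
Qed.

Canonical comm_equiv := EquivRel comm_rel comm_rel_refl comm_rel_sym comm_rel_trans.

(* The carrier of A / [A, A]. *)
Definition sing_type : Type := {eq_quot comm_equiv}.

Definition sing_pi (x : A) : sing_type := \pi_({eq_quot comm_equiv}) (x : {classic A}).
Definition sing_repr (u : sing_type) : A := repr (u : {eq_quot comm_equiv}).

Lemma sing_reprK u : sing_pi (sing_repr u) = u.
Proof. exact: reprK. Qed.

Lemma sing_piP (x y : A) : sing_pi x = sing_pi y <-> commutator A (x - y).
Proof.
split=> [h|h]; first by apply/comm_relP; exact: (introT (eqmodP comm_equiv x y) h).
by apply: (elimT (eqmodP comm_equiv x y)); apply/comm_relP.
Qed.

Lemma sing_repr_pi (D : object C) (g : hom A D) (x : A) :
  commutator_gens A `<=` kernel g -> g (sing_repr (sing_pi x)) = g x.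
Proof.
move=> hg; move: (sing_reprK (sing_pi x)) => /sing_piP/commutator_subP.
exact.
Qed.

Definition sing_alg : algebra C := {|
  carrier := sing_type;
  zero := sing_pi 0;
  opp u := sing_pi (- sing_repr u);
  add u v := sing_pi (sing_repr u + sing_repr v);
  un w u := sing_pi (un w (sing_repr u));
  bin o u v := sing_pi (sing_repr u *[o] sing_repr v) |}.

Definition sing_unit_alg : hom A sing_alg.
Proof.
refine (@Hom _ A sing_alg sing_pi _ _ _ _ _) => //= *;
  apply/sing_piP/commutator_subP => D g hg.
- by rewrite !homN sing_repr_pi.
- by rewrite !homD !sing_repr_pi.
- by rewrite !homU sing_repr_pi.
- by rewrite !homM !sing_repr_pi.
Defined.

Lemma eval_hom (S : signature) (V : Type) (X Y : algebra S) (g : hom X Y)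
  (e : V -> X) (t : term S V) : g (eval e t) = eval (fun v => g (e v)) t.
Proof.
elim: t => //= [|t <-|s <- t <-|w t <-|o s <- t <-].
- exact: hom0.
- exact: homN.
- exact: homD.
- exact: homU.
- exact: homM.
Qed.

Lemma sing_algP (s t : term C nat) : identities s t ->
  forall e : nat -> sing_alg, eval e s = eval e t.
Proof.
move=> hst e.
have -> : e = (fun n => sing_unit_alg (sing_repr (e n))).
  by apply/funext => n; rewrite /= sing_reprK.
by rewrite -!eval_hom (objP hst).
Qed.

Definition sing : object C := Object sing_algP.

Definition sing_unit : hom A sing := sing_unit_alg.

Lemma sing_unit_surj : surjective sing_unit.
Proof. by move=> u; exists (sing_repr u); exact: sing_reprK. Qed.

Lemma commutator_gens_unit : commutator_gens A `<=` kernel sing_unit.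
Proof.
move=> u hu; apply/sing_piP/commutator_subP => D g hg.
by rewrite hom0; exact: hg.
Qed.

Lemma kernel_sing_unit : kernel sing_unit = commutator A.
Proof.
apply/seteqP; split=> [x|x]; last first.
  by apply; split; [exists sing, sing_unit | exact: commutator_gens_unit].
move=> /sing_piP h I [[D [g ->]] hg].
by rewrite /kernel /= -(hom0 g); move/commutator_subP : h; exact.
Qed.

Lemma commutator_ideal : is_ideal (commutator A).
Proof. by exists sing, sing_unit; rewrite kernel_sing_unit. Qed.

Lemma sing_singular : singular sing.
Proof.
have comm (u v : sing) : u + v = v + u.
  have [x <-] := sing_unit_surj u; have [y <-] := sing_unit_surj v.
  have h0 : sing_unit (x + y - x - y) = 0.
    by apply: commutator_gens_unit; exists x, y; constructor 1.
  have h : sing_unit x + sing_unit y - sing_unit x = sing_unit y.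
    apply/sub_eq0; rewrite -h0.
    by rewrite !homD !homN.
  have hx : sing_unit x + sing_unit y - sing_unit x + sing_unit x =
            sing_unit x + sing_unit y.
    by rewrite -(mci_addA (_ + _)) mci_addNx mci_addx0.
  by rewrite -hx h.
have mul0 (u v : sing) o : u *[o] v = 0.
  have [x <-] := sing_unit_surj u; have [y <-] := sing_unit_surj v.
  rewrite -homM; apply: commutator_gens_unit; exists x, y.
  by constructor 3; exists o.
by apply/seteqP; split=> // z _; split=> *; rewrite ?mul0 // comm.
Qed.

Lemma sing_universal (D : object C) (g : hom A D) : singular D ->
  exists h : hom sing D, (forall x, h (sing_unit x) = g x) /\
    forall h' : hom sing D, (forall x, h' (sing_unit x) = g x) ->
    forall u, h' u = h u.
Proof.
move=> sD.
have zD (z : D) : center D z by rewrite sD.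
have hg : commutator_gens A `<=` kernel g.
  have gun1 w y : g (un1 w y) = un1 w (g y).
    by case: w => [w|] /=; [exact: homU | exact: homN].
  have gC x y : g (x + y - x - y) = 0.
    rewrite !homD !homN; have [-> _ _ _] := zD (g y).
    by rewrite -(mci_addA (g y)) mci_addxN mci_addx0 mci_addxN.
  have gM x o y : g (x *[o] y) = 0.
    by rewrite homM; have [_ _ -> _] := zD (g y).
  by move=> u [x [y [->|[w ->]|[o ->]|[w [o ->]]]]]; rewrite /kernel /=.
have gK x : g (sing_repr (sing_unit x)) = g x by exact: sing_repr_pi.
unshelve eexists (@Hom _ sing D (fun u => g (sing_repr u)) _ _ _ _ _).
- exact: etrans (gK _) (hom0 g).
- by move=> u; exact: etrans (gK _) (homN g _).
- by move=> u v; exact: etrans (gK _) (homD g _ _).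
- by move=> w u; exact: etrans (gK _) (homU g _ _).
- by move=> o u v; exact: etrans (gK _) (homM g _ _ _).
- split=> [x|h' hh' u] /=; first exact: gK.
  by have [x <-] := sing_unit_surj u; rewrite gK hh'.
Qed.

End Sing.

Section SingMap.
Variables (C : modified_category_of_interest) (A B : object C) (f : hom A B).

Lemma hom_un1 (S : signature) (X Y : algebra S) (g : hom X Y) w (x : X) :
  g (un1 w x) = un1 w (g x).
Proof. by case: w => [w|] /=; [exact: homU | exact: homN]. Qed.

Lemma commutator_gens_hom (x : A) :
  commutator_gens A x -> commutator_gens B (f x).
Proof.
move=> [a [b h]]; exists (f a), (f b).
case: h => [->|[w ->]|[o ->]|[w [o ->]]].
- by constructor 1; rewrite !homD !homN.
- by constructor 2; exists w; rewrite !homD !homN !hom_un1.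
- by constructor 3; exists o; rewrite homM.
- by constructor 4; exists w, o; rewrite homM hom_un1.
Qed.

Definition hom_comp (S : signature) (X Y Z : algebra S) (h : hom Y Z) (g : hom X Y) :
  hom X Z.
Proof.
by refine (@Hom _ X Z (h \o g) _ _ _ _ _) => /= *;
  rewrite ?(hom0, homN, homD, homU, homM).
Defined.

Definition sing_map_fun (u : sing A) : sing B := sing_unit B (f (sing_repr u)).

Lemma sing_map_unit (x : A) : sing_map_fun (sing_unit A x) = sing_unit B (f x).
Proof.
apply: (sing_repr_pi (g := hom_comp (sing_unit B) f)) => y hy.
by apply: commutator_gens_unit; exact: commutator_gens_hom.
Qed.

Definition sing_map : hom (sing A) (sing B).
Proof.
refine (@Hom _ (sing A) (sing B) sing_map_fun _ _ _ _ _).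
- by rewrite -(hom0 (sing_unit A)) sing_map_unit !hom0.
- move=> u; have [x <-] := sing_unit_surj u.
  by rewrite -homN !sing_map_unit !homN.
- move=> u v; have [x <-] := sing_unit_surj u; have [y <-] := sing_unit_surj v.
  by rewrite -homD !sing_map_unit !homD.
- move=> w u; have [x <-] := sing_unit_surj u.
  by rewrite -homU !sing_map_unit !homU.
- move=> o u v; have [x <-] := sing_unit_surj u; have [y <-] := sing_unit_surj v.
  by rewrite -homM !sing_map_unit !homM.
Defined.

End SingMap.

(* The square p : P -> X, q : P -> Y over f : X -> Z, g : Y -> Z is a pullback
   in the category of objects of T. *)
Definition is_pullback (T : variety) (P X Y Z : object T)
    (p : hom P X) (q : hom P Y) (f : hom X Z) (g : hom Y Z) : Prop :=
  (forall x, f (p x) = g (q x)) /\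
  forall (Q : object T) (p' : hom Q X) (q' : hom Q Y),
    (forall x, f (p' x) = g (q' x)) ->
    exists u : hom Q P,
      [/\ forall x, p (u x) = p' x,
          forall x, q (u x) = q' x &
          forall v : hom Q P,
            (forall x, p (v x) = p' x) -> (forall x, q (v x) = q' x) ->
            forall x, v x = u x].

Section FibreProduct.
Variables (T : variety) (X Y Z : object T) (f : hom X Z) (g : hom Y Z).

Definition fibre_type : Type := {p : X * Y | f p.1 = g p.2}.

Lemma fibre_eq (u v : fibre_type) :
  (sval u).1 = (sval v).1 -> (sval u).2 = (sval v).2 -> u = v.
Proof.
case: u v => [[a b] p] [[c d] q] /= ea eb.
by move: p q; rewrite ea eb => p q; rewrite (Prop_irrelevance p q).
Qed.

Definition fibre_mk (x : X) (y : Y) (h : f x = g y) : fibre_type :=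
  exist (fun p : X * Y => f p.1 = g p.2) (x, y) h.

Definition fibre_alg : algebra T.
Proof.
refine {| carrier := fibre_type;
  zero := @fibre_mk 0 0 _;
  opp u := @fibre_mk (- (sval u).1) (- (sval u).2) _;
  add u v := @fibre_mk ((sval u).1 + (sval v).1) ((sval u).2 + (sval v).2) _;
  un w u := @fibre_mk (un w (sval u).1) (un w (sval u).2) _;
  bin o u v := @fibre_mk ((sval u).1 *[o] (sval v).1) ((sval u).2 *[o] (sval v).2) _ |}.
- by rewrite !hom0.
- by rewrite !homN (svalP u).
- by rewrite !homD (svalP u) (svalP v).
- by rewrite !homU (svalP u).
- by rewrite !homM (svalP u) (svalP v).
Defined.

Definition fibre_alg1 : hom fibre_alg X :=
  @Hom _ fibre_alg X (fun u => (sval u).1) erefl (fun _ => erefl)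
    (fun _ _ => erefl) (fun _ _ => erefl) (fun _ _ _ => erefl).

Definition fibre_alg2 : hom fibre_alg Y :=
  @Hom _ fibre_alg Y (fun u => (sval u).2) erefl (fun _ => erefl)
    (fun _ _ => erefl) (fun _ _ => erefl) (fun _ _ _ => erefl).

Lemma fibre_algP (s t : term T nat) : identities s t ->
  forall e : nat -> fibre_alg, eval e s = eval e t.
Proof.
move=> hst e; apply: fibre_eq.
- by rewrite -[LHS]/(fibre_alg1 _) -[RHS]/(fibre_alg1 _) !eval_hom (objP hst).
- by rewrite -[LHS]/(fibre_alg2 _) -[RHS]/(fibre_alg2 _) !eval_hom (objP hst).
Qed.

Definition fibre_product : object T := Object fibre_algP.
Definition fibre_pr1 : hom fibre_product X := fibre_alg1.
Definition fibre_pr2 : hom fibre_product Y := fibre_alg2.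

Lemma fibre_product_pullback : is_pullback fibre_pr1 fibre_pr2 f g.
Proof.
split=> [x|Q p q h]; first exact: (svalP x).
have hom_u : exists u : hom Q fibre_product, forall x, u x = fibre_mk (h x).
  unshelve eexists (@Hom _ Q fibre_product (fun x => fibre_mk (h x)) _ _ _ _ _).
  - by apply: fibre_eq; rewrite /= hom0.
  - by move=> x; apply: fibre_eq; rewrite /= homN.
  - by move=> x y; apply: fibre_eq; rewrite /= homD.
  - by move=> w x; apply: fibre_eq; rewrite /= homU.
  - by move=> o x y; apply: fibre_eq; rewrite /= homM.
  - by [].
have [u hu] := hom_u.
exists u; split=> [x|x|v h1 h2 x]; rewrite hu //.
by apply: fibre_eq; [exact: h1 | exact: h2].
Qed.

End FibreProduct.

(* A >-> B ->> D: the map f is surjective, and k is (up to isomorphism) the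
   inclusion of its kernel. *)
Definition is_extension (S : signature) (A B D : algebra S)
    (k : hom A B) (f : hom B D) : Prop :=
  [/\ injective k, range k = kernel f & surjective f].

Definition is_central_extension (S : signature) (A B : algebra S) (k : hom A B) : Prop :=
  singular A /\ range k `<=` center B.

Definition is_trivial (C : modified_category_of_interest) (A B : object C)
    (f : hom A B) : Prop :=
  surjective f /\
  is_pullback f (sing_unit A) (sing_unit B) (sing_map f).

Definition is_JK_central (C : modified_category_of_interest) (A B : object C)
    (f : hom A B) : Prop :=
  surjective f /\
  exists (E : object C) (rho : hom E B),
    surjective rho /\ is_trivial (fibre_pr1 rho f).

(* Main.v *)
(** Both directions rest on the fact that a square is a pullback exactly when
    its comparison map to the fibre product is bijective.  If the kernel of [f]
    is central, pull [f] back along itself: [(x, y) |-> y - x] is then a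
    homomorphism from the kernel pair to the singular object [A], so it factors
    through the singularization and separates the points of each fibre of the
    first projection; the diagonal [B -> B x_D B] provides the missing
    preimages.  Conversely, if [pr1 : E x_D B -> E] is trivial, then for [z] in
    the kernel of [f] and [rho e = f b] the commutators and products of [(e, b)]
    with [(0, z)] lie over [0] in [E] and vanish in the singularization, hence
    are [0]. *)

From mathcomp Require Import all_boot.
From mathcomp Require Import boolp classical_sets.
Require Import Defs.

Set Implicit Arguments.
Unset Strict Implicit.
Unset Printing Implicit Defensive.

Local Open Scope classical_set_scope.
Local Open Scope mci_scope.

Definition hom_id (S : signature) (A : algebra S) : hom A A :=
  @Hom S A A id erefl (fun=> erefl) (fun _ _ => erefl)
    (fun _ _ => erefl) (fun _ _ _ => erefl).

(** The universal property only tests against objects, so the concrete fibre product serves as test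
    object: the comparison [c] from [P] to it has a left inverse [u], and [c a] is determined by
    [p a] and [q a]. *)
Lemma pullback_joint_inj (T : variety) (P X Y Z : object T)
    (p : hom P X) (q : hom P Y) (f : hom X Z) (g : hom Y Z) :
  is_pullback p q f g -> forall a b, p a = p b -> q a = q b -> a = b.
Proof.
move=> [comm univ] a b pab qab.
have [c [c1 c2 _]] := (fibre_product_pullback f g).2 P p q comm.
have [u [u1 u2 _]] :=
  univ _ (fibre_pr1 f g) (fibre_pr2 f g) (fibre_product_pullback f g).1.
have [v [_ _ vE]] := univ _ p q comm.
(* Both [u] after [c] and the identity mediate from [P] to itself. *)
have uc x : u (c x) = x.
  have -> : u (c x) = v x.
    by apply: (vE (hom_comp u c)) => y /=; rewrite ?u1 ?u2 ?c1 ?c2.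
  by rewrite -(vE (hom_id P)).
rewrite -(uc a) -(uc b); congr (u _).
apply: fibre_eq.
- exact: etrans (c1 a) (etrans pab (esym (c1 b))).
- exact: etrans (c2 a) (etrans qab (esym (c2 b))).
Qed.

(** Choice supplies the mediating function; joint injectivity makes it a homomorphism and unique. *)
Lemma pointwise_pullback (T : variety) (P X Y Z : object T)
    (p : hom P X) (q : hom P Y) (f : hom X Z) (g : hom Y Z) :
  (forall a, f (p a) = g (q a)) ->
  (forall a b, p a = p b -> q a = q b -> a = b) ->
  (forall x y, f x = g y -> exists a, p a = x /\ q a = y) ->
  is_pullback p q f g.
Proof.
move=> comm inj surj; split=> // Q p' q' comm'.
have [u uE] := choice (fun x => surj _ _ (comm' x)).
have u1 x : p (u x) = p' x by have [] := uE x.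
have u2 x : q (u x) = q' x by have [] := uE x.
unshelve eexists (@Hom _ Q P u _ _ _ _ _).
- by apply: (inj); rewrite ?u1 ?u2 !hom0.
- by move=> x; apply: (inj); rewrite homN ?u1 ?u2 homN.
- by move=> x y; apply: (inj); rewrite homD ?u1 ?u2 homD.
- by move=> w x; apply: (inj); rewrite homU ?u1 ?u2 homU.
- by move=> o x y; apply: (inj); rewrite homM ?u1 ?u2 homM.
- split=> // v v1 v2 x.
  by apply: (inj); [exact: etrans (v1 x) (esym (u1 x))
                 | exact: etrans (v2 x) (esym (u2 x))].
Qed.

Section Algebra.
Variable C : modified_category_of_interest.
Implicit Types A B D E : object C.

Lemma add_cancelr A (x y z : A) : x + z = y + z -> x = y.
Proof.
move=> h; rewrite -[x]mci_addx0 -(mci_addxN z) mci_addA h.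
by rewrite -mci_addA mci_addxN mci_addx0.
Qed.

Lemma bin_x0 A o (x : A) : x *[o] 0 = 0.
Proof.
by apply: (@add_cancelr _ _ _ (x *[o] 0)); rewrite -mci_binDr !mci_add0x.
Qed.

Lemma un_0 A w : un w (0 : A) = 0.
Proof.
by apply: (@add_cancelr _ _ _ (un w (0 : A))); rewrite -mci_unD !mci_add0x.
Qed.

Lemma bin_opposite A o :
  exists o', forall x y : A, x *[o] y = y *[o'] x.
Proof. by have [o' h] := mci_opposite o; exists o' => x y; rewrite h. Qed.

Lemma mci_binDl A o (x y z : A) : (x + y) *[o] z = x *[o] z + y *[o] z.
Proof. by have [o' h] := bin_opposite A o; rewrite !h mci_binDr. Qed.

Lemma center_addC A (z a : A) : center A z -> a + z = z + a.
Proof. by case. Qed.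

Lemma center_bin_r A (z a : A) o : center A z -> a *[o] z = 0.
Proof. by case. Qed.

Lemma center_bin_l A (z a : A) o : center A z -> z *[o] a = 0.
Proof. by have [o' ->] := bin_opposite A o; case. Qed.

(** A kernel is stable under all unary operations, so the center conditions on [un1 w z] are
    instances of those on [z]. *)
Lemma kernel_centerP B D (f : hom B D) :
  (forall b z, kernel f z -> b + z = z + b /\ forall o, b *[o] z = 0) ->
  kernel f `<=` center B.
Proof.
move=> h z fz.
have fwz w : kernel f (un1 w z).
  rewrite /kernel /= hom_un1 fz; case: w => [w|] /=; first exact: un_0.
  by rewrite -[LHS]mci_addx0 mci_addNx.
split=> [a|a w|a o|a w o].
- by have [] := h a _ fz.
- by have [] := h a _ (fwz w).
- by have [_] := h a _ fz.
- by have [_] := h a _ (fwz w).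
Qed.

Lemma additive_hom A B (g : A -> B) :
  (forall x y, g (x + y) = g x + g y) ->
  (forall w x, g (un w x) = un w (g x)) ->
  (forall o x y, g (x *[o] y) = g x *[o] g y) ->
  exists h : hom A B, forall x, h x = g x.
Proof.
move=> gD gU gM.
have g0 : g 0 = 0.
  by apply: (@add_cancelr _ _ _ (g 0)); rewrite -gD !mci_add0x.
have gN x : g (- x) = - g x.
  by apply: (@add_cancelr _ _ _ (g x)); rewrite -gD !mci_addNx.
by exists (@Hom _ A B g g0 gN gD gU gM).
Qed.

Lemma center_singular A B (k : hom A B) :
  injective k -> range k `<=` center B -> singular A.
Proof.
move=> kI kZ; have kc x : center B (k x) by apply: kZ; exists x.
apply/seteqP; split=> // z _.
have cA x y : x + y = y + x :> A.
  by apply: kI; rewrite !homD; exact: center_addC.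
have mA x y o : x *[o] y = 0 :> A.
  by apply: kI; rewrite homM hom0; exact: center_bin_r.
by split.
Qed.

Lemma kernel_pair_difference A B D (k : hom A B) (f : hom B D) :
  injective k -> range k = kernel f -> range k `<=` center B ->
  exists g : hom (fibre_product f f) A,
    forall u, (sval u).2 = k (g u) + (sval u).1.
Proof.
move=> kI kE kZ; have kc x : center B (k x) by apply: kZ; exists x.
have diff (u : fibre_product f f) : exists a, (sval u).2 = k a + (sval u).1.
  have : kernel f ((sval u).2 - (sval u).1).
    by rewrite /kernel /= homD homN (svalP u) mci_addxN.
  rewrite -kE => -[a _ ka]; exists a.
  by rewrite ka -mci_addA mci_addNx mci_addx0.
have [g gE] := choice diff.
(* The defining equation determines [g u], so each homomorphism law reduces to checking that
   equation. *)
have gP u a : (sval u).2 = k a + (sval u).1 -> g u = a.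
  by move=> h; apply: kI; apply: (@add_cancelr _ _ _ (sval u).1); rewrite -gE.
have [|||h hE] := @additive_hom (fibre_product f f) A g.
- move=> u v; apply: gP => /=; rewrite !gE homD -!mci_addA; congr add.
  by rewrite !mci_addA (center_addC (sval u).1 (kc (g v))).
- by move=> w u; apply: gP; rewrite /= gE mci_unD homU.
(* Every product with a factor in the range of [k] vanishes; only the product of the first
   coordinates survives. *)
- move=> o u v; apply: gP; rewrite /= !gE mci_binDl !mci_binDr homM.
  by rewrite !(center_bin_l _ _ (kc _)) (center_bin_r _ _ (kc _)) !mci_add0x.
- by exists h => u; rewrite hE.
Qed.

Lemma central_kernel_pair_trivial A B D (k : hom A B) (f : hom B D) :
  injective k -> range k = kernel f -> range k `<=` center B ->
  is_trivial (fibre_pr1 f f).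
Proof.
move=> kI kE kZ; have [g gE] := kernel_pair_difference kI kE kZ.
(* [d] is the diagonal of the kernel pair. *)
have [d [d1 _ _]] :=
  (fibre_product_pullback f f).2 B (hom_id B) (hom_id B) (fun=> erefl).
split; first by move=> x; exists (d x); exact: d1.
apply: pointwise_pullback => [u|u v uv1 uvS|b s bs].
- exact: esym (sing_map_unit _ _).
- have [h [hE _]] := sing_universal g (center_singular kI kZ).
  have guv : g u = g v by rewrite -!hE uvS.
  by apply: fibre_eq; rewrite // gE guv [RHS]gE; congr add.
- have [u uE] := sing_unit_surj s; rewrite -uE.
  have {}bs : sing_unit B b = sing_unit B (fibre_pr1 f f u).
    by rewrite bs -uE; exact: sing_map_unit.
  (* The correction added to [u] moves its first coordinate to [b]. It vanishes in the
     singularization, because [b] and the first coordinate of [u] have the same class and [d]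
     induces a map on classes. *)
  exists (d b - d (fibre_pr1 f f u) + u); split.
    rewrite !homD homN.
    by rewrite !d1 -mci_addA mci_addNx mci_addx0.
  rewrite !homD homN -!(sing_map_unit d) bs.
  by rewrite mci_addxN mci_add0x.
Qed.

Lemma trivial_pullback_central B D E (f : hom B D) (rho : hom E D) :
  surjective rho -> is_trivial (fibre_pr1 rho f) -> kernel f `<=` center B.
Proof.
move=> rhoS [_ /pullback_joint_inj inj].
apply: kernel_centerP => b z fz.
have [e re] := rhoS (f b).
have rz : rho 0 = f z by rewrite hom0 fz.
pose p : fibre_product rho f := fibre_mk re.
pose q : fibre_product rho f := fibre_mk rz.
have unitC (x y : fibre_product rho f) :
    sing_unit _ (x + y) = sing_unit _ (y + x).
  by rewrite !homD; apply: center_addC; rewrite sing_singular.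
split=> [|o].
(* Both sums lie over [e] and have equal classes; their second coordinates are [b + z] and
   [z + b]. *)
- have : p + q = q + p.
    apply: inj; last exact: unitC.
    exact: etrans (mci_addx0 e) (esym (mci_add0x e)).
  by move=> /(congr1 (fibre_pr2 rho f)).
- have : p *[o] q = 0.
    apply: inj; first exact: bin_x0.
    rewrite [LHS]homM [RHS]hom0; apply: center_bin_r.
    by rewrite sing_singular.
  by move=> /(congr1 (fibre_pr2 rho f)).
Qed.

End Algebra.

Theorem proposition26 (C : modified_category_of_interest) (A B D : object C)
    (k : hom A B) (f : hom B D) (hext : is_extension k f) :
  is_central_extension k <-> is_JK_central f.
Proof.
have [kI kE fS] := hext; split=> [[_ kZ]|[_ [E [rho [rhoS triv]]]]].
- split=> //; exists B, f; split=> //.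
  exact: central_kernel_pair_trivial kI kE kZ.
- have kZ : range k `<=` center B.
    by rewrite kE; exact: trivial_pullback_central rhoS triv.
  by split=> //; exact: center_singular kI kZ.
Qed.
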